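(* Let $q>0$ be an odd integer and $0\le b\le q$. Let $\widetilde{\mathsf{Uni}}(q-b,b)$ be the set of isomorphism classes (of unitary $\mathrm{BT}_1$ modules) of unitary unicycles of signature $(q-b,b)$. Then $$\#\widetilde{\mathsf{Uni}}(q-b,b) = \frac{1}{q}\sum_{d\,\mid\,\gcd(q,b)}\mu(d) \binom{q/d}{b/d},$$ where the sum is over positive divisors $d$ of $\gcd(q,b)$ and $\mu$ is the Möbius function.
   Context: $k$ is an algebraically closed field of prime characteristic $p>2$. A word is a nonempty finite string $w=u_{\ell-1}\cdots u_0$ in $\{\mathtt f,\mathtt v\}$, of length $\ell$; $w$ is primitive if it is not a concatenation of $n>1$ copies of a shorter word; $w^\star$ is obtained by exchanging $\mathtt f$ and $\mathtt v$. A unitary $\mathrm{BT}_1$ module is $(M,F,V,\lambda,M=M_0\oplus M_1)$ with $M$ a finite-dimensional $k$-vector space, $F$ Frobenius-linear, $V$ inverse-Frobenius-linear, $\ker F=\operatorname{im}V$, $\ker V=\operatorname{im}F$, $\lambda$ a symplectic form on $M$ with $\lambda(F(x),y)=\lambda(x,V(y))^p$, $F,V$ mapping $M_i$ into $M_{1-i}$, and $M_0,M_1$ Lagrangian. Its signature is $(\dim_k\ker(F|_{M_1}),\dim_k\ker(F|_{M_0}))$. Isomorphisms are $k$-linear isomorphisms respecting all the structure. For a word $w=u_{2m-1}\cdots u_0$ of the form $w=yy^\star$, primitive, with $y$ of odd length $m$, the unitary unicycle $\widetilde M(w)$ has $k$-basis $a_0,\dots,a_{2m-1}$ (indices mod $2m$),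 $F(a_j)=a_{j+1}$ if $u_j=\mathtt f$ and $0$ if $u_j=\mathtt v$; $V(a_{j+1})=a_j$ if $u_j=\mathtt v$ and $0$ if $u_j=\mathtt f$; $\lambda(a_i,a_j)=c^{p^i}$ if $j\equiv i+m \pmod{2m}$ and $0$ otherwise, where $c\in k^\times$ is fixed with $c^{p^m}=-c$; $M_0=\operatorname{span}\{a_j:j\text{ even}\}$, $M_1=\operatorname{span}\{a_j:j\text{ odd}\}$. Convention: $\gcd(q,0)=q$. *)

(* Defs.v *)
From mathcomp Require Import all_boot all_algebra.

Set Implicit Arguments.
Unset Strict Implicit.
Unset Printing Implicit Defensive.

Import GRing.Theory.

Local Open Scope ring_scope.

(* A word u_(l-1) ... u_0 is the sequence of its letters in written order,
   so that u_0 is its last item. *)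
Inductive letter := lf | lv.

Definition star_letter (x : letter) := match x with lf => lv | lv => lf end.

Definition star (w : seq letter) := map star_letter w.

(* The letter u_j of w, with j read modulo the length of w. *)
Definition letter_at (w : seq letter) (j : nat) : letter :=
  nth lf (rev w) (j %% size w).

(* In particular a primitive word is nonempty. *)
Definition primitive (w : seq letter) : Prop :=
  forall (n : nat) (z : seq letter), (1 < n)%N -> w <> flatten (nseq n z).

Definition lagrangian (k : fieldType) (U : vectType k)
    (lam : {skew_symmetric U}) (L : {vspace U}) : Prop :=
  orthov lam L = L.

(* ubt_part false and ubt_part true are the summands M_0 and M_1. *)
Record unitaryBT1 (k : closedFieldType) (p : nat) := UnitaryBT1 {
  ubt_sort :> vectType k;
  ubt_F : {additive ubt_sort -> ubt_sort};
  ubt_V : {additive ubt_sort -> ubt_sort};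
  ubt_lam : {skew_symmetric ubt_sort};
  ubt_part : bool -> {vspace ubt_sort};
  ubt_FZ : forall (a : k) x, ubt_F (a *: x) = a ^+ p *: ubt_F x;
  ubt_VZ : forall (a : k) x, ubt_V (a ^+ p *: x) = a *: ubt_V x;
  ubt_kerF : forall x, ubt_F x = 0 <-> exists y, x = ubt_V y;
  ubt_kerV : forall x, ubt_V x = 0 <-> exists y, x = ubt_F y;
  ubt_symplectic : is_psymplectic ubt_lam;
  ubt_lamFV : forall x y, ubt_lam (ubt_F x) y = ubt_lam x (ubt_V y) ^+ p;
  ubt_decomp : (ubt_part false + ubt_part true)%VS = fullv;
  ubt_direct : directv (ubt_part false + ubt_part true);
  ubt_Fpart : forall i x, x \in ubt_part i -> ubt_F x \in ubt_part (~~ i);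
  ubt_Vpart : forall i x, x \in ubt_part i -> ubt_V x \in ubt_part (~~ i);
  ubt_lagrangian : forall i, lagrangian ubt_lam (ubt_part i)
}.

Section UnitaryBT1.
Variables (k : closedFieldType) (p : nat).
Implicit Types M N : unitaryBT1 k p.

Definition isomorphic M N : Prop :=
  exists h : {linear M -> N},
    [/\ bijective h,
        forall x, h (ubt_F M x) = ubt_F N (h x),
        forall x, h (ubt_V M x) = ubt_V N (h x),
        forall x y, ubt_lam N (h x) (h y) = ubt_lam M x y
      & forall i x, (h x \in ubt_part N i) = (x \in ubt_part M i)].

Definition iso_class M : unitaryBT1 k p -> Prop := isomorphic M.

(* F is only semilinear, so its kernel on M_i is specified by its elements. *)
Definition dim_kerF M (i : bool) (n : nat) : Prop :=
  exists2 K : {vspace M},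
    forall x, (x \in K) = (x \in ubt_part M i) && (ubt_F M x == 0)
    & \dim K = n.

Definition has_signature M (s : nat * nat) : Prop :=
  dim_kerF M true s.1 /\ dim_kerF M false s.2.

(* M is (a copy of) the unitary unicycle of a word w of length 2m, for the
   scalar c. The basis is extended to a 2m-periodic family indexed by nat. *)
Definition is_unicycle_of (m : nat) (w : seq letter) (c : k) M : Prop :=
  exists a : nat -> M,
    [/\ forall j, a (j + m.*2)%N = a j,
        basis_of fullv [seq a j | j <- iota 0 m.*2],
        forall j, ubt_F M (a j) = (if letter_at w j is lf then a j.+1 else 0)
          /\ ubt_V M (a j.+1) = (if letter_at w j is lv then a j else 0),
        forall i j, ubt_lam M (a i) (a j) =
          (if (j == i + m %[mod m.*2])%N then c ^+ (p ^ i) else 0)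
      & forall i : bool,
          ubt_part M i = <<[seq a j | j <- iota 0 m.*2 & odd j == i]>>%VS].

(* c m is the scalar fixed for the words of length 2m. *)
Definition unitary_unicycle (c : nat -> k) M : Prop :=
  exists y : seq letter,
    [/\ odd (size y), primitive (y ++ star y)
      & is_unicycle_of (size y) (y ++ star y) (c (size y)) M].

(* A set of isomorphism classes, each class being a predicate on modules. *)
Definition Uni (c : nat -> k) (s : nat * nat)
    (C : unitaryBT1 k p -> Prop) : Prop :=
  exists M, [/\ unitary_unicycle c M, has_signature M s & C = iso_class M].

End UnitaryBT1.

(* The finite cardinality of MathComp-Analysis is not available for Uni: the
   universe of its sets is too small to contain unitaryBT1. *)
Definition has_card (T : Type) (A : T -> Prop) (n : nat) : Prop :=
  exists2 e : 'I_n -> T,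
    forall i j, e i = e j -> i = j
    & forall x, A x <-> exists i, x = e i.

(* Only meant for n > 0. *)
Definition mobius (n : nat) : int :=
  if all (fun r => logn r n == 1%N) (primes n) then (-1) ^+ size (primes n)
  else 0.

(* Main.v *)
Require Import Defs.
From HB Require Import structures.
From mathcomp Require Import all_boot all_algebra all_fingroup cyclic.
From mathcomp Require Import boolp zify ring.

(* A word u of length 2q with u = y (star y) and q odd is a subset A of Z/q:
   Z/2q = Z/2 x Z/q, and exchanging f and v at the odd positions makes u
   invariant under translation by q. The word is primitive iff no nonzero
   translation of Z/q fixes A, and the signature of its unicycle is
   (q - #A, #A). Two such unicycles are isomorphic iff the subsets are
   translates of each other. If they are, an even rotation of the basis,
   rescaled by a root of an equation over k, is an isomorphism. Conversely, the
   matrix of an isomorphism is triangular for the lexicographic order on the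
   rotations of the words, so the smallest even rotations of the two words
   agree. Hence q times the cardinality sought is the number of b-element
   subsets of Z/q with trivial stabiliser, which is computed by Moebius
   inversion over the subgroups of Z/q: the b-element subsets invariant under
   the subgroup of order d are the unions of b/d cosets. *)

Set Implicit Arguments.
Unset Strict Implicit.
Unset Printing Implicit Defensive.

Import GRing.Theory Num.Theory.

Local Open Scope ring_scope.

(** * Aperiodic subsets of a cyclic group *)

Lemma mobius_primeM r e : prime r -> (0 < e)%N ->
  mobius (r * e) = if (r %| e)%N then 0 else - mobius e.
Proof.
move=> r_pr e_gt0; have r_gt0 := prime_gt0 r_pr; rewrite /mobius.
have lognr: logn r (r * e) = (logn r e).+1 by rewrite lognM // logn_prime // eqxx.
have [r_dvd_e | r_ndvd_e] := boolP (r %| e)%N.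
  rewrite ifF //; apply/negbTE/allPn; exists r.
    by rewrite primesM // mem_primes r_pr r_gt0 dvdnn.
  by rewrite lognr eqSS -lt0n logn_gt0 mem_primes r_pr e_gt0.
have primes_re: perm_eq (primes (r * e)) (r :: primes e).
  apply: uniq_perm => [||x]; first exact: primes_uniq.
    by rewrite /= primes_uniq mem_primes (negPf r_ndvd_e) !andbF.
  by rewrite primesM // primes_prime // !inE.
rewrite (perm_all _ primes_re) (perm_size primes_re) /=.
rewrite lognr lognE (negPf r_ndvd_e) !andbF /=.
have eq_logn: {in primes e, forall x, logn x (r * e) = logn x e}.
  move=> x; rewrite mem_primes => /and3P[x_pr _ x_dvd].
  rewrite lognM // logn_prime //; case: eqP => // xr.
  by rewrite -xr x_dvd in r_ndvd_e.
rewrite (eq_in_all (a2 := fun x => logn x e == 1%N)) => [|x /eq_logn -> //].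
by case: ifP; rewrite ?oppr0 // exprS mulN1r.
Qed.

(** Fix a prime factor r of n > 1. A divisor re contributes 0 if r divides e and [- mobius e]
    otherwise, and the e of the second kind are exactly the divisors of n prime to r, so the sum
    cancels. *)
Lemma sum_mobius n : (0 < n)%N -> \sum_(d <- divisors n) mobius d = (n == 1)%:R.
Proof.
case: (ltngtP n 1) => [|n_gt1 _|-> _]; first by rewrite ltnS leqn0 => /eqP ->.
  have n_gt0 := ltnW n_gt1; set r := pdiv n.
  have r_pr : prime r by exact: pdiv_prime.
  have r_gt0 := prime_gt0 r_pr; have r_dvd: (r %| n)%N by exact: pdiv_dvd.
  have nr_gt0: (0 < n %/ r)%N by rewrite divn_gt0 // (dvdn_leq n_gt0).
  rewrite (bigID (fun d => r %| d)%N) /= -big_filter.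
  have multiples: perm_eq [seq d <- divisors n | r %| d]%N
                          [seq (r * e)%N | e <- divisors (n %/ r)].
    apply: uniq_perm => [||d]; first exact/filter_uniq/divisors_uniq.
      rewrite map_inj_uniq ?divisors_uniq // => x y /eqP.
      by rewrite eqn_pmul2l // => /eqP.
    rewrite mem_filter -dvdn_divisors //.
    apply/andP/mapP => [[rd dn]|[e e_dvd ->]].
      exists (d %/ r)%N; last by rewrite mulnC divnK.
      by rewrite -dvdn_divisors // dvdn_divRL // divnK.
    by rewrite dvdn_mulr // mulnC -dvdn_divRL // dvdn_divisors.
  have coprimes: perm_eq [seq d <- divisors (n %/ r) | ~~ (r %| d)]%N
                         [seq d <- divisors n | ~~ (r %| d)]%N.
    apply: uniq_perm => [||d]; try exact/filter_uniq/divisors_uniq.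
    rewrite !mem_filter -!dvdn_divisors //; case: (boolP (r %| d)%N) => //= rd.
    rewrite -[in RHS](divnK r_dvd) Gauss_dvdl //.
    by rewrite coprime_sym prime_coprime.
  rewrite (perm_big _ multiples) big_map big_seq.
  under eq_bigr => e e_dvd.
    rewrite mobius_primeM //; last first.
      by move: e_dvd; rewrite -dvdn_divisors // => /dvdn_gt0 ->.
    over.
  rewrite -big_seq (bigID (fun d => r %| d)%N) /= big1 => [|e ->//].
  rewrite add0r -big_filter (perm_big _ coprimes) big_filter.
  rewrite -big_split /= big1 // => e /negPf ->.
  by rewrite addrC subrr.
by rewrite big_seq1.
Qed.

(** * Subsets of a group invariant under translation by a subgroup *)

Section SubsetsOfGroup.
Local Open Scope group_scope.
Variable gT : finGroupType.
Implicit Types (A : {set gT}) (G H : {group gT}).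

(** The product form says that [A] is a union of left cosets of [H], which is how invariant sets are
    counted below. *)
Lemma astab_RsP H A : reflect (A * H = A) (H \subset 'C[A | 'Rs]).
Proof.
apply: (iffP subsetP) => [fixA | AH x xH].
  apply/setP=> x; apply/mulsgP/idP => [[a h aA hH ->]|xA].
    have /astab1P <- := fixA h hH.
    by rewrite /= rcosetE mem_rcoset mulgK.
  by exists x 1; rewrite ?group1 ?mulg1.
apply/astab1P; rewrite /= -AH; apply/setP=> y.
by rewrite rcosetE -mulgA rcoset_id.
Qed.

(** Mapping an invariant set to the left cosets of its elements is a bijection onto the families of
    left cosets, with inverse [cover]. Taking [cover] multiplies the cardinality by the order of
    [H], so that order must divide b. *)
Lemma card_translation_invariant H b :
  #|[set A : {set gT} | (H \subset 'C[A | 'Rs]) && (#|A| == b)]| =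
  if (#|H| %| b)%N then 'C(#|gT| %/ #|H|, b %/ #|H|) else 0%N.
Proof.
pose f A := [set x *: H | x in A].
have H_gt0 := cardG_gt0 H.
have coverf A : cover (f A) = A * H.
  apply/setP=> x; apply/bigcupP/mulsgP => [[_ /imsetP[a aA ->]] | [a h aA hH ->]].
    by case/lcosetP=> h hH ->; exists a h.
  by exists (a *: H); [exact: imset_f | rewrite mem_lcoset mulKg].
have part : partition (lcosets H [set: gT]) [set: gT].
  have -> : lcosets H [set: gT] = [set orbit 'R H x | x in [set: gT]].
    by apply: eq_imset => x; rewrite orbitR lcosetE.
  by apply: orbit_partition; apply/actsP=> a _ x; rewrite !inE.
have cardP (P : {set {set gT}}) : P \subset lcosets H [set: gT] ->
    #|cover P| = (#|P| * #|H|)%N.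
  move=> sP; apply: card_uniform_partition (_ : partition P (cover P)).
    by move=> A /(subsetP sP)/lcosetsP[x _ ->]; rewrite card_lcoset.
  case/and3P: part => _ triv /negP n0; apply/and3P; split=> //.
    exact: trivIsetS triv.
  by apply/negP => /(subsetP sP).
have sf A : f A \subset lcosets H [set: gT].
  by apply/subsetP=> _ /imsetP[a _ ->]; apply/lcosetsP; exists a.
have cardfA A : H \subset 'C[A | 'Rs] -> #|A| = (#|f A| * #|H|)%N.
  by move/astab_RsP=> AH; rewrite -cardP // coverf AH.
case: ifPn => [/dvdnP[c ->] | ndvd]; last first.
  apply/eqP; rewrite cards_eq0; apply/eqP/setP=> A; rewrite !inE.
  apply/andP=> -[/cardfA cA /eqP bA]; move: ndvd; rewrite -bA cA.
  by rewrite dvdn_mull.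
rewrite mulnK //.
have inj_f : {in [set A | (H \subset 'C[A | 'Rs]) && (#|A| == c * #|H|)%N] &,
              injective f}.
  move=> A B; rewrite !inE => /andP[/astab_RsP AH _] /andP[/astab_RsP BH _].
  by move=> /(congr1 cover); rewrite !coverf AH BH.
rewrite -(card_in_imset inj_f).
have -> : (#|gT| %/ #|H|)%N = #|lcosets H [set: gT]|.
  by rewrite card_lcosets -divgS ?subsetT // cardsT.
rewrite -cards_draws; congr #|pred_of_set _|; apply/setP=> P; rewrite !inE.
apply/imsetP/andP => [[A] | [sP /eqP cP]].
  rewrite inE => /andP[/cardfA cA /eqP]; rewrite {}cA => cA ->.
  by rewrite sf; split=> //; rewrite -(eqn_pmul2r H_gt0) cA.
exists (cover P).
  rewrite inE cardP // cP eqxx andbT; apply/astab_RsP.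
  apply/setP=> x.
  apply/mulsgP/bigcupP => [[a h /bigcupP[A AP aA] hH ->] | [A AP xA]].
    exists A => //; have /lcosetsP[y _ Ay] := subsetP sP A AP.
    by move: aA; rewrite Ay !mem_lcoset mulgA (groupMr _ hH).
  by exists x 1; rewrite ?mulg1 //; apply/bigcupP; exists A.
apply/setP=> A; apply/idP/imsetP => [AP | [x /bigcupP[B BP xB] ->]].
  have /lcosetsP[y _ Ay] := subsetP sP A AP.
  exists y => //; apply/bigcupP; exists A => //; rewrite Ay; exact: lcoset_refl.
have /lcosetsP[y _ By] := subsetP sP B BP.
by move: xB; rewrite By => /lcoset_eqP ->; rewrite -By.
Qed.

(** By [sum_mobius], triviality of a stabiliser is the sum of [mobius d] over the divisors d of its
    order. Exchanging the sums leaves, for each d, the number of sets whose stabiliser has order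
    divisible by d. *)
Lemma card_aperiodic_sets b : cyclic [set: gT] ->
  #|[set A : {set gT} | (#|A| == b) && ('C[A | 'Rs] == 1)]|%:Z =
  (\sum_(d <- divisors (gcdn #|gT| b))
     mobius d * 'C(#|gT| %/ d, b %/ d)%:Z)%R.
Proof.
move=> cycG; have q_gt0 : (0 < #|gT|)%N by rewrite -cardsT cardG_gt0.
have subgroup d : (d %| #|gT|)%N -> exists H : {group gT}, #|H| = d.
  move=> d_dvd; have [a Ga] := cyclicP cycG.
  exists <[a ^+ (#|gT| %/ d)]>%G; rewrite -[LHS]/#[_].
  have oa : #[a] = #|gT| by rewrite -cardsT Ga.
  rewrite orderXdiv oa ?dvdn_div //.
  by rewrite divnA // mulKn.
have count d : (d %| #|gT|)%N ->
    #|[set A : {set gT} | (#|A| == b) && (d %| #|'C[A | 'Rs]|)%N]| =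
    if (d %| b)%N then 'C(#|gT| %/ d, b %/ d) else 0%N.
  move=> /subgroup[H <-]; rewrite -card_translation_invariant.
  congr #|pred_of_set _|; apply/setP=> A; rewrite !inE andbC.
  (* In a cyclic group, inclusion of subgroups is divisibility of their orders. *)
  by rewrite (cardSg_cyclic cycG) ?subsetT.
rewrite -sum1dep_card.
have -> : ((\sum_(A : {set gT} | (#|A| == b) && ('C[A | 'Rs] == 1)%g) 1)%N)%:Z =
  (\sum_(A : {set gT} | #|A| == b)
     \sum_(d <- divisors #|gT| | (d %| #|'C[A | 'Rs]|)%N) mobius d)%R.
  rewrite big_mkcondr /= -natz natr_sum; apply: eq_bigr => A _.
  rewrite -big_filter.
  have -> : (('C[A | 'Rs] == 1 :> {set gT}) = (#|'C[A | 'Rs]| == 1)%N).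
    by rewrite -trivg_card1.
  rewrite (perm_big (divisors #|'C[A | 'Rs]|)) /=.
    by rewrite sum_mobius ?cardG_gt0 //; case: (_ == _).
  apply: uniq_perm => [||d]; rewrite ?filter_uniq ?divisors_uniq //.
  rewrite mem_filter -!dvdn_divisors ?cardG_gt0 //.
  case: (boolP (d %| _)%N) => //= /dvdn_trans -> //.
  by rewrite -cardsT cardSg ?subsetT.
under eq_bigr do rewrite big_mkcond.
rewrite exchange_big /=.
transitivity (\sum_(d <- divisors #|gT| | (d %| b)%N)
                 mobius d * 'C(#|gT| %/ d, b %/ d)%:Z)%R.
  rewrite [RHS]big_mkcond big_seq [RHS]big_seq; apply: eq_bigr => d.
  rewrite -dvdn_divisors // => /count cnt.
  rewrite -big_mkcondr /= sumr_const /=.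
  rewrite -[mobius d *+ _]mulr_natr.
  have -> : #|[pred A : {set gT} | (#|A| == b) && (d %| #|'C[A | 'Rs]|)%N]| =
     if (d %| b)%N then 'C(#|gT| %/ d, b %/ d) else 0%N.
    by rewrite -cnt; apply: eq_card => A; rewrite !inE.
  by case: ifP; rewrite ?mulr0 // natz.
rewrite -[LHS]big_filter; apply: perm_big; apply: uniq_perm => [||d].
- exact/filter_uniq/divisors_uniq.
- exact: divisors_uniq.
by rewrite mem_filter -!dvdn_divisors ?gcdn_gt0 ?q_gt0 // dvdn_gcd andbC.
Qed.

End SubsetsOfGroup.

(** * Translation orbits of aperiodic subsets *)

Section AperiodicOrbits.
Local Open Scope group_scope.
Variables (gT : finGroupType) (b : nat).

Definition aperiodic_sets :=
  [set A : {set gT} | (#|A| == b) && ('C[A | 'Rs] == 1)].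

Lemma acts_aperiodic_sets : [acts [set: gT], on aperiodic_sets | 'Rs].
Proof.
apply/actsP=> a _ A.
by rewrite !inE (astab1_act 'Rs) conjsg_eq1 /= rcosetE card_rcoset.
Qed.

(** Stabilisers are trivial, so every orbit has as many elements as the group. *)
Lemma card_orbit_transversal_aperiodic :
  (#|orbit_transversal 'Rs [set: gT] aperiodic_sets| * #|gT|)%N =
  #|aperiodic_sets|.
Proof.
have [trX _ _ _] := orbit_transversalP acts_aperiodic_sets.
rewrite (card_transversal trX); apply/esym/card_uniform_partition; last first.
  exact: orbit_partition acts_aperiodic_sets.
move=> _ /imsetP[A /[!inE]/andP[_ /eqP A_aper] ->].
by rewrite card_orbit setTI A_aper indexg1 cardsT.
Qed.
End AperiodicOrbits.

(** * The standard module of a word *)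

Section PthRoot.
Variables (k : closedFieldType) (p : nat).
Hypothesis p_char : p \in [pchar k].

Lemma expp_additive : zmod_morphism (fun x : k => x ^+ p).
Proof. by move=> x y; rewrite -!(pFrobenius_autE p_char) rmorphB. Qed.

Lemma expp_inj : injective (fun x : k => x ^+ p).
Proof. by move=> x y; rewrite -!(pFrobenius_autE p_char) => /fmorph_inj. Qed.

Lemma exists_root n (x : k) : (0 < n)%N -> exists y, y ^+ n == x.
Proof.
move=> n_gt0.
have [y yE] := solve_monicpoly (fun i => if i == 0%N then x else 0) n_gt0.
exists y; rewrite yE; case: n n_gt0 {yE} => // n _.
by rewrite big_ord_recl expr0 mulr1 big1 ?addr0 // => i _; rewrite mul0r.
Qed.

(** The inverse of Frobenius: by [expp_inj] the chosen root is the only one, which makes [proot]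
    additive and multiplicative. *)
Definition proot (x : k) :=
  xchoose (exists_root x (prime_gt0 (pcharf_prime p_char))).

Lemma prootK x : proot x ^+ p = x.
Proof. exact/eqP/(xchooseP (exists_root x _)). Qed.

Lemma expp_proot x : proot (x ^+ p) = x.
Proof. by apply: expp_inj; rewrite prootK. Qed.

Lemma expp0 : (0 : k) ^+ p = 0.
Proof. by rewrite expr0n gtn_eqF ?(prime_gt0 (pcharf_prime p_char)). Qed.

Lemma proot0 : proot 0 = 0.
Proof. by rewrite -[in LHS]expp0 expp_proot. Qed.

Lemma proot_additive : zmod_morphism proot.
Proof.
by move=> x y; apply: expp_inj; rewrite expp_additive !prootK.
Qed.

Lemma prootM x y : proot (x * y) = proot x * proot y.
Proof. by apply: expp_inj; rewrite /= exprMn !prootK. Qed.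

End PthRoot.

(** * Cyclic indices and coordinate subspaces *)

Section ModularIndices.
Variable n : nat.

Lemma inZpD i j : inZp (i + j) = inZp i + inZp j :> 'I_n.+1.
Proof. by apply: val_inj; rewrite /= modnDm. Qed.

Lemma inZpS i : inZp i.+1 = inZp i + inZp 1 :> 'I_n.+1.
Proof. by rewrite -(addn1 i) inZpD. Qed.

Lemma inZp_eq i j : (inZp i == inZp j :> 'I_n.+1) = (i == j %[mod n.+1])%N.
Proof. by []. Qed.

Lemma inZp_mod i : inZp (i %% n.+1) = inZp i :> 'I_n.+1.
Proof. by apply: val_inj; rewrite /= modn_mod. Qed.

Lemma modn_periodic (T : Type) (f : nat -> T) d i :
  (forall j, f (j + d)%N = f j) -> f (i %% d)%N = f i.
Proof.
move=> per; rewrite [in RHS](divn_eq i d); elim: (i %/ d)%N => [|a IH] //.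
by rewrite mulSn -addnA addnC per.
Qed.

Variable k : fieldType.

(** The standard basis as a periodic family over nat, the shape required by [is_unicycle_of]. *)
Definition cyc_row (j : nat) : 'rV[k]_n.+1 := delta_mx 0 (inZp j).

Lemma mem_span_cyc_row (P : pred nat) (x : 'rV[k]_n.+1) :
  reflect (forall i : 'I_n.+1, ~~ P i -> x 0 i = 0)
    (x \in <<[seq cyc_row j | j <- iota 0 n.+1 & P j]>>%VS).
Proof.
apply: (iffP idP) => [x_span i Pi | x0].
  rewrite (coord_span (X := in_tuple _) x_span) summxE big1 // => j _.
  have /mapP[l l_in eq_l] := mem_nth 0 (ltn_ord j).
  rewrite mxE {}eq_l mxE eqxx /=; case: eqP => [il|_]; last by rewrite mulr0.
  move: l_in; rewrite mem_filter mem_iota /= => /andP[Pl l_lt].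
  by move: Pi; rewrite il /= modn_small ?Pl.
rewrite [x]row_sum_delta; apply: memv_suml => i _.
have [Pi | /x0 ->] := boolP (P i); last by rewrite scale0r mem0v.
apply/memvZ/memv_span/mapP; exists (val i); last by rewrite /cyc_row valZpK.
by rewrite mem_filter Pi mem_iota /=.
Qed.

Lemma cyc_row_basis : basis_of fullv [seq cyc_row j | j <- iota 0 n.+1].
Proof.
rewrite basisEdim size_map size_iota dimvf dim_matrix mul1r leqnn andbT.
apply/subvP=> x _; rewrite -[iota 0 n.+1]filter_predT.
exact/mem_span_cyc_row.
Qed.

Lemma dim_span_cyc_row (P : pred nat) :
  \dim <<[seq cyc_row j | j <- iota 0 n.+1 & P j]>>%VS = count P (iota 0 n.+1).
Proof.
rewrite -size_filter -[RHS](size_map cyc_row).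
apply/eqP; rewrite -/(free _); have := basis_free cyc_row_basis.
have /(perm_map cyc_row)/perm_free <- : perm_eq _ (iota 0 n.+1) :=
  permEl (perm_filterC P _).
by rewrite map_cat; apply: catl_free.
Qed.
End ModularIndices.

Lemma double_period (T : Type) (g : T -> T) (f : nat -> T) m :
  involutive g -> (forall j, f (j + m)%N = g (f j)) ->
  forall j, f (j + m.*2)%N = f j.
Proof. by move=> gK fg j; rewrite -addnn addnA !fg gK. Qed.

(** * Construction of a unitary BT_1 module from a sequence of letters *)

Section StandardModule.
Variables (k : closedFieldType) (p : nat).
Hypothesis p_char : p \in [pchar k].
Hypothesis p_odd : odd p.
Variable m' : nat.
Notation m := m'.+1.
(** Here [n.+1] is 2m, so that ['I_n.+1] carries the group structure of Z/2m. *)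
Notation n := m'.*2.+1.
Hypothesis m_odd : odd m.
Variable c : k.
Hypothesis c_neq0 : c != 0.
Hypothesis c_conj : c ^+ (p ^ m) = - c.
(** [u j] is true when the letter at j is v; [u_flip] expresses the form y (star y). *)
Variable u : nat -> bool.
Hypothesis u_flip : forall j, u (j + m) = ~~ u j.

Implicit Types (x y : 'rV[k]_n.+1) (i : 'I_n.+1).

Let expc j := c ^+ (p ^ j).

(** Raise [c_conj] to the power p^j, which is odd and so keeps the sign. *)
Lemma expc_flip j : expc (j + m) = - expc j.
Proof.
rewrite /expc expnD mulnC exprM c_conj exprNn -signr_odd oddX p_odd orbT.
by rewrite expr1 mulN1r.
Qed.

Lemma expc_neq0 j : expc j != 0. Proof. exact: expf_neq0. Qed.

Lemma expcS j : expc j.+1 = expc j ^+ p.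
Proof. by rewrite /expc expnSr exprM. Qed.

Lemma ord_addE (T : Type) (f : nat -> T) i d :
  (forall j, f (j + n.+1)%N = f j) -> f (i + inZp d : 'I_n.+1)%R = f (i + d)%N.
Proof. by move=> per; rewrite /= modnDmr (modn_periodic _ per). Qed.

Let u_per : forall j, u (j + n.+1) = u j := double_period negbK u_flip.
Let expc_per : forall j, expc (j + n.+1) = expc j :=
  double_period (@opprK _) expc_flip.

Lemma odd_per j : odd (j + n.+1) = odd j.
Proof. by rewrite oddD /= odd_double addbF. Qed.

(** The Frobenius-linear extension of the rule on basis vectors, in coordinates: the entry at i
    comes from the letter at i - 1. *)
Definition std_F x : 'rV[k]_n.+1 :=
  \row_i (if u (i - inZp 1 : 'I_n.+1)%R then 0 else x 0 (i - inZp 1)%R ^+ p).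

Definition std_V x : 'rV[k]_n.+1 :=
  \row_i (if u i then proot p_char (x 0 (i + inZp 1)%R) else 0).

Definition std_lam x y : k :=
  \sum_(i < n.+1) expc i * (x 0 i * y 0 (i + inZp m)%R).

Definition std_part (b : bool) : {vspace 'rV[k]_n.+1} :=
  <<[seq cyc_row n k j | j <- iota 0 m.*2 & odd j == b]>>%VS.

Lemma std_partP b x :
  reflect (forall i, odd i != b -> x 0 i = 0) (x \in std_part b).
Proof. exact: (mem_span_cyc_row (fun j => odd j == b)). Qed.

Lemma std_FE x i : std_F x 0 (i + inZp 1)%R = if u i then 0 else x 0 i ^+ p.
Proof. by rewrite mxE addrK. Qed.

Lemma std_F_additive : zmod_morphism std_F.
Proof.
move=> x y; apply/rowP=> i; rewrite !mxE (expp_additive p_char).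
by case: ifP; rewrite ?subr0.
Qed.

Lemma std_V_additive : zmod_morphism std_V.
Proof.
move=> x y; apply/rowP=> i; rewrite !mxE proot_additive.
by case: ifP; rewrite ?subr0.
Qed.

HB.instance Definition _ :=
  GRing.isZmodMorphism.Build 'rV[k]_n.+1 'rV[k]_n.+1 std_F std_F_additive.
HB.instance Definition _ :=
  GRing.isZmodMorphism.Build 'rV[k]_n.+1 'rV[k]_n.+1 std_V std_V_additive.

Lemma std_lam_bilinear :
  bilinear_for
    (GRing.Scale.Law.clone _ _ ( *%R ) _)
    (GRing.Scale.Law.clone _ _ (idfun \; *%R ) _) std_lam.
Proof.
split=> [y|x] a x1 x2; rewrite /std_lam /= mulr_sumr -big_split /=.
  by apply: eq_bigr => i _; rewrite !mxE; ring.
by apply: eq_bigr => i _; rewrite !mxE; ring.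
Qed.

HB.instance Definition _ :=
  bilinear_isBilinear.Build k _ _ _
    (GRing.Scale.Law.clone _ _ ( *%R ) _)
    (GRing.Scale.Law.clone _ _ (idfun \; *%R ) _) std_lam std_lam_bilinear.

Lemma inZp_mm i : i + inZp m + inZp m = i.
Proof.
rewrite -addrA -inZpD; rewrite addnn doubleS.
by rewrite -inZp_mod modnn -[RHS]addr0; congr (_ + _); apply: val_inj.
Qed.

(** Translating the index by m exchanges the two arguments and changes the sign of [expc]. *)
Lemma std_lam_skew x y : std_lam x y = (-1) ^+ true * idfun (std_lam y x).
Proof.
rewrite expr1 mulN1r /= /std_lam (reindex_inj (addIr (inZp m))) /= -sumrN.
apply: eq_bigr => i _; rewrite inZp_mm (ord_addE _ _ expc_per) expc_flip.
by rewrite [x 0%R _ * _]mulrC mulNr.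
Qed.

HB.instance Definition _ :=
  isHermitianSesquilinear.Build k _ true idfun std_lam std_lam_skew.

(** Pairing with a basis vector reads off a coordinate up to a nonzero factor; nondegeneracy and the
    Lagrangian property follow from this. *)
Lemma std_lam_delta x i :
  std_lam x (delta_mx 0 (i + inZp m)%R) = expc i * x 0 i.
Proof.
rewrite /std_lam (bigD1 i) //= big1 => [|j ji].
  by rewrite mxE !eqxx mulr1 addr0.
by rewrite mxE (inj_eq (addIr _)) (negPf ji) !mulr0.
Qed.

Lemma std_FZ a x : std_F (a *: x) = a ^+ p *: std_F x.
Proof.
by apply/rowP=> i; rewrite !mxE exprMn; case: ifP; rewrite ?mulr0.
Qed.

Lemma std_VZ a x : std_V (a ^+ p *: x) = a *: std_V x.
Proof.
by apply/rowP=> i; rewrite !mxE prootM expp_proot; case: ifP; rewrite ?mulr0.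
Qed.

Lemma std_F_eq0P x : reflect (forall i, ~~ u i -> x 0 i = 0) (std_F x == 0).
Proof.
apply: (iffP eqP) => [Fx0 i /negPf ui | x0].
  have := congr1 (fun z : 'rV_n.+1 => z 0 (i + inZp 1)%R) Fx0.
  by rewrite std_FE ui mxE => /eqP; rewrite expf_eq0 => /andP[_ /eqP].
apply/rowP=> i; rewrite !mxE; case: ifPn => // /x0 ->; exact: expp0.
Qed.

(** Both conditions say that x is supported on the indices with letter v. The preimage under V takes
    p-th powers and shifts by one. *)
Lemma std_kerF x : std_F x = 0 <-> exists y, x = std_V y.
Proof.
split=> [/eqP/std_F_eq0P Fx0 | [y ->]].
  exists (\row_i (x 0 (i - inZp 1)%R ^+ p)); apply/rowP=> i.
  by rewrite !mxE addrK expp_proot; case: ifPn => [//|/Fx0].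
by apply/eqP/std_F_eq0P=> i /negPf ui; rewrite mxE ui.
Qed.

Lemma std_kerV x : std_V x = 0 <-> exists y, x = std_F y.
Proof.
split=> [Vx0 | [y ->]]; last first.
  by apply/rowP=> i; rewrite !mxE addrK; case: (u i); rewrite ?proot0.
exists (\row_i proot p_char (x 0 (i + inZp 1)%R)); apply/rowP=> i.
rewrite !mxE prootK subrK; case: ifPn => // ui.
have := congr1 (fun z : 'rV_n.+1 => z 0 (i - inZp 1)%R) Vx0.
by rewrite !mxE ui subrK => /(congr1 (fun z => z ^+ p)); rewrite prootK expp0.
Qed.

Lemma std_symplectic : is_psymplectic (std_lam : {skew_symmetric 'rV[k]_n.+1}).
Proof.
split=> //; last first.
  by rewrite (pcharf_eq p_char) => /eqP p2; move: p_odd; rewrite -p2.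
rewrite /nondegenerate -subv0; apply/subvP=> x /mem_orthovP x_orth.
rewrite memv0; apply/eqP/rowP=> i; rewrite mxE.
have /eqP : std_lam x _ = 0 := x_orth (delta_mx 0 (i + inZp m)%R) (memvf _).
by rewrite std_lam_delta mulf_eq0 (negPf (expc_neq0 _)) => /eqP.
Qed.

(** Compare the terms at i + 1 and i. The left one survives when the letter at i is f, the right one
    when the letter at i + m is v; by [u_flip] these agree. *)
Lemma std_lamFV x y : std_lam (std_F x) y = std_lam x (std_V y) ^+ p.
Proof.
rewrite /std_lam (reindex_inj (addIr (inZp 1))).
rewrite -(pFrobenius_autE p_char) rmorph_sum; apply: eq_bigr => i _.
rewrite std_FE mxE (ord_addE _ _ expc_per) (ord_addE _ _ u_per) u_flip.
rewrite addn1 expcS [RHS]/= pFrobenius_autE !exprMn addrAC.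
by case: (u i); rewrite /= ?prootK ?expp0 ?mul0r ?mulr0.
Qed.

Lemma std_decomp : (std_part false + std_part true)%VS = fullv.
Proof.
apply/vspaceP=> x; rewrite memvf; apply/memv_addP.
exists (\row_i if odd i then 0 else x 0 i).
  by apply/std_partP=> i; rewrite mxE; case: odd.
exists (\row_i if odd i then x 0 i else 0).
  by apply/std_partP=> i; rewrite mxE; case: odd.
by apply/rowP=> i; rewrite !mxE; case: odd; rewrite ?add0r ?addr0.
Qed.

Lemma std_direct : directv (std_part false + std_part true).
Proof.
apply/directv_addP/eqP; rewrite -subv0; apply/subvP=> x.
rewrite memv_cap memv0 => /andP[/std_partP x0 /std_partP x1].
apply/eqP/rowP=> i; rewrite mxE.
by case odd_i: (odd i); [apply: x0 | apply: x1]; rewrite odd_i.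
Qed.

Lemma std_Fpart b x : x \in std_part b -> std_F x \in std_part (~~ b).
Proof.
move/std_partP=> x0; apply/std_partP=> i; rewrite -[i](subrK (inZp 1)) std_FE.
rewrite (ord_addE _ _ odd_per) addn1 /= => odd_i; rewrite x0.
  by rewrite expp0 ?if_same.
by case: odd odd_i; case: b {x0}.
Qed.

Lemma std_Vpart b x : x \in std_part b -> std_V x \in std_part (~~ b).
Proof.
move/std_partP=> x0; apply/std_partP=> i odd_i.
rewrite mxE x0 ?proot0 ?if_same //.
by rewrite (ord_addE _ _ odd_per) addn1 /=; case: odd odd_i; case: b {x0}.
Qed.

(** As m is odd, i and i + m have opposite parities, so the form pairs each coordinate of one part
    with a coordinate of the other. *)
Lemma std_lagrangian b :
  lagrangian (std_lam : {skew_symmetric 'rV[k]_n.+1}) (std_part b).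
Proof.
have odd_m i : odd (i + inZp m : 'I_n.+1)%R = ~~ odd i.
  by rewrite (ord_addE _ _ odd_per) oddD m_odd addbT.
apply/vspaceP=> x.
apply/mem_orthovP/std_partP => [x_orth i odd_i | x0 y /std_partP y0].
  have /eqP: std_lam x (delta_mx 0 (i + inZp m)%R) = 0.
    apply: x_orth; apply/std_partP=> j odd_j; rewrite mxE eqxx /=.
    case: (j =P _) odd_j => //= ->; rewrite odd_m.
    by case: odd odd_i; case: b.
  by rewrite std_lam_delta mulf_eq0 (negPf (expc_neq0 _)) => /eqP.
apply: big1 => i _; have [ib|/x0 ->] := boolP (odd i == b); last first.
  by rewrite mul0r mulr0.
by rewrite y0 ?mulr0 // odd_m (eqP ib); case: b {ib x0 y0}.
Qed.

Definition std_module : unitaryBT1 k p :=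
  UnitaryBT1 std_FZ std_VZ std_kerF std_kerV std_symplectic std_lamFV
    std_decomp std_direct std_Fpart std_Vpart std_lagrangian.

Notation e := (cyc_row n k).

Lemma u_ord j : u (inZp j : 'I_n.+1) = u j.
Proof. by rewrite /= (modn_periodic _ u_per). Qed.

Lemma cyc_rowE j i : e j 0 i = (i == inZp j)%:R.
Proof. by rewrite mxE eqxx. Qed.

Lemma cyc_rowSE j i : e j.+1 0 (i + inZp 1)%R = (i == inZp j)%:R.
Proof. by rewrite cyc_rowE (inZpS _ j) (inj_eq (addIr _)). Qed.

Lemma std_F_cyc_row j : std_F (e j) = if u j then 0 else e j.+1.
Proof.
apply/rowP=> i; rewrite -[i](subrK (inZp 1)); move: (i - inZp 1) => {}i.
rewrite std_FE cyc_rowE.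
transitivity (if u j then 0 else (i == inZp j)%:R : k); last first.
  by case: (u j); rewrite /= ?cyc_rowSE // mxE.
have [->|_] := eqVneq i (inZp j); first by rewrite u_ord expr1n.
by rewrite expp0 // !if_same.
Qed.

Lemma std_V_cyc_row j : std_V (e j.+1) = if u j then e j else 0.
Proof.
apply/rowP=> i; rewrite mxE cyc_rowSE.
transitivity (if u j then (i == inZp j)%:R else 0 : k); last first.
  by case: (u j); rewrite /= ?cyc_rowE // mxE.
have [->|_] := eqVneq i (inZp j); last by rewrite proot0 !if_same.
by rewrite u_ord /= -[in LHS](expr1n _ p) expp_proot.
Qed.

Lemma std_unicycle (w : seq letter) :
  (forall j, letter_at w j = if u j then lv else lf) ->
  is_unicycle_of m w c std_module.
Proof.
move=> w_u; exists e; split=> //.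
- by move=> j; rewrite /cyc_row -inZp_mod modnDr inZp_mod.
- exact: cyc_row_basis.
- move=> j; rewrite w_u; split.
    by rewrite [LHS]std_F_cyc_row; case: (u j).
  by rewrite [LHS]std_V_cyc_row; case: (u j).
- move=> i j; rewrite {2}/cyc_row -[inZp j](subrK (inZp m)) [LHS]std_lam_delta.
  rewrite cyc_rowE subr_eq -inZpD inZp_eq.
  have -> : (m.*2 = n.+1)%N by rewrite doubleS.
  case: eqP => [ji|_]; last by rewrite mulr0.
  have -> : inZp j = inZp (i + m) :> 'I_n.+1.
    by apply/eqP; rewrite inZp_eq; apply/eqP.
  by rewrite inZpD addrK /= (modn_periodic _ expc_per) mulr1.
Qed.

(** The kernel is a coordinate subspace, spanned by the basis vectors of parity b whose letter is
    v. *)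
Lemma std_dim_kerF b :
  dim_kerF std_module b (count (fun j => (odd j == b) && u j) (iota 0 m.*2)).
Proof.
pose P j := (odd j == b) && u j.
exists <<[seq e j | j <- iota 0 n.+1 & P j]>>%VS; last exact: dim_span_cyc_row.
move=> x; apply/mem_span_cyc_row/andP => [x0|[/std_partP x0 /std_F_eq0P Fx0] i].
  split; first by apply/std_partP=> i odd_i; rewrite x0 ?negb_and ?odd_i.
  by apply/std_F_eq0P=> i u_i; rewrite x0 ?negb_and ?u_i ?orbT.
by rewrite negb_and => /orP[/x0|/Fx0].
Qed.

End StandardModule.

(** * Isomorphisms of unicycles *)

Section Isomorphisms.
Variables (k : closedFieldType) (p : nat).
Implicit Types M N P : unitaryBT1 k p.

Lemma dim_kerF_inj M b r s : dim_kerF M b r -> dim_kerF M b s -> r = s.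
Proof.
case=> K mem_K <- [L mem_L <-]; congr (\dim _); apply/vspaceP=> x.
by rewrite mem_K mem_L.
Qed.

Lemma isomorphic_refl M : isomorphic M M.
Proof. by exists (idfun : {linear M -> M}); split=> //; exists idfun. Qed.

Lemma isomorphic_sym M N : isomorphic M N -> isomorphic N M.
Proof.
case=> h [[g hK gK] hF hV hlam hpart].
pose g_lin := GRing.isLinear.Build _ _ _ _ g (can2_linear hK gK).
pose g' : {linear N -> M} := HB.pack g g_lin; exists g'.
have inj_h := can_inj hK; rewrite /g' /=; split=> [|x|x|x y|i x].
- by exists h.
- by apply: inj_h; rewrite hF !gK.
- by apply: inj_h; rewrite hV !gK.
- by rewrite -hlam !gK.
- by rewrite -hpart gK.
Qed.

Lemma isomorphic_trans M N P :
  isomorphic M N -> isomorphic N P -> isomorphic M P.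
Proof.
case=> h [h_bij hF hV hlam hpart] [g [g_bij gF gV glam gpart]].
exists (g \o h : {linear M -> P}); split=> [|x|x|x y|i x] /=.
- exact: bij_comp.
- by rewrite hF gF.
- by rewrite hV gV.
- by rewrite glam hlam.
- by rewrite gpart hpart.
Qed.

(** Classes are predicates, so their equality rests on functional and propositional
    extensionality. *)
Lemma iso_class_eq M N : isomorphic M N <-> iso_class M = iso_class N.
Proof.
split=> [MN | eq_MN]; last first.
  by rewrite -[isomorphic M N]/(iso_class M N) eq_MN; apply: isomorphic_refl.
apply/funext=> P; apply/propext; split; last exact: isomorphic_trans.
exact/isomorphic_trans/isomorphic_sym.
Qed.

Lemma isomorphic_dim_kerF M N b n :
  isomorphic M N -> dim_kerF M b n -> dim_kerF N b n.
Proof.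
case=> h [[g hK gK] hF _ _ hpart] [K mem_K <-].
exists (linfun h @: K)%VS; last first.
  rewrite limg_dim_eq //; apply/eqP; rewrite -subv0; apply/subvP=> x.
  rewrite memv_cap memv_ker lfunE /= memv0 => /andP[_ /eqP hx0].
  by rewrite -(hK x) hx0 -(raddf0 h) hK.
move=> x; rewrite -[x]gK; set y := g x; rewrite hpart -hF.
rewrite -(raddf0 h) (inj_eq (can_inj hK)) -mem_K.
apply/memv_imgP/idP => [[z zK]|yK]; last by exists y; rewrite ?lfunE.
by rewrite lfunE => /(can_inj hK) ->.
Qed.

Lemma isomorphic_signature M N s :
  isomorphic M N -> has_signature M s -> has_signature N s.
Proof. by move=> MN [s1 s2]; split; apply: isomorphic_dim_kerF MN _. Qed.

Lemma basis_expansion (U : vectType k) (a : nat -> U) n :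
  basis_of fullv [seq a j | j <- iota 0 n] ->
  forall x, exists f : nat -> k, x = \sum_(j < n) f j *: a j.
Proof.
move=> a_basis x; set X := [seq a j | j <- iota 0 n] in a_basis.
have X_size : size X == n by rewrite size_map size_iota.
have x_coord := coord_basis (X := Tuple X_size) a_basis (memvf x).
(* The coefficients are extended by 0 from n on. *)
exists (fun j => if insub j is Some i then coord (Tuple X_size) i x else 0).
rewrite [LHS]x_coord; apply: eq_bigr => i _; rewrite valK.
by rewrite (nth_map 0%N) ?size_iota // nth_iota.
Qed.

Lemma linear_on_basis (U W : vectType k) (a : nat -> U) (b : nat -> W) n :
  basis_of fullv [seq a j | j <- iota 0 n] ->
  exists h : {linear U -> W}, forall j, (j < n)%N -> h (a j) = b j.
Proof.
move=> a_basis.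
have [h h_map] :=
  linear_of_free [seq a j | j <- iota 0 n] [seq b j | j <- iota 0 n].
exists h => j j_lt.
have := h_map (basis_free a_basis); rewrite !size_map => /(_ erefl).
move/(congr1 (fun s => nth 0 s j)); rewrite -map_comp.
by rewrite !(nth_map 0%N) ?size_iota // nth_iota.
Qed.

Lemma form_expand (U : vectType k) (lam : {skew_symmetric U})
    (a : nat -> U) n f g :
  lam (\sum_(i < n) f i *: a i) (\sum_(j < n) g j *: a j) =
  \sum_(i < n) \sum_(j < n) f i * (g j * lam (a i) (a j)).
Proof.
rewrite linear_sumlz; apply: eq_bigr => i _; rewrite linear_sumr.
by apply: eq_bigr => j _; rewrite linearZl_LR linearZr_LR.
Qed.

(** The conditions of [is_unicycle_of] on a given family, so that the bases of two modules can be
    matched. *)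
Definition unicycle_basis m w (c : k) M (a : nat -> M) :=
    [/\ forall j, a (j + m.*2)%N = a j,
        basis_of fullv [seq a j | j <- iota 0 m.*2],
        forall j, ubt_F M (a j) = (if letter_at w j is lf then a j.+1 else 0)
          /\ ubt_V M (a j.+1) = (if letter_at w j is lv then a j else 0),
        forall i j, ubt_lam M (a i) (a j) =
          (if (j == i + m %[mod m.*2])%N then c ^+ (p ^ i) else 0)
      & forall i : bool,
          ubt_part M i = <<[seq a j | j <- iota 0 m.*2 & odd j == i]>>%VS].

Hypothesis p_char : p \in [pchar k].

(** All the structure is determined by its values on the basis, and these are given by the same
    formulas in both modules. *)
Lemma unicycle_hom m w c M N a b : (0 < m)%N ->
  @unicycle_basis m w c M a -> @unicycle_basis m w c N b ->
  exists h : {linear M -> N},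
    [/\ forall j, h (a j) = b j,
        forall x, h (ubt_F M x) = ubt_F N (h x),
        forall x, h (ubt_V M x) = ubt_V N (h x),
        forall x y, ubt_lam N (h x) (h y) = ubt_lam M x y
      & forall i x, x \in ubt_part M i -> h x \in ubt_part N i].
Proof.
move=> m_gt0 [a_per a_basis aFV a_lam a_part] [b_per b_basis bFV b_lam b_part].
have [h h_lt] := linear_on_basis b a_basis.
have ha j : h (a j) = b j.
  rewrite -(modn_periodic j a_per) -(modn_periodic j b_per) h_lt //.
  by rewrite ltn_mod double_gt0.
have expand := basis_expansion a_basis.
exists h; split=> // [x|x|x y|i x].
- have [f ->] := expand x; rewrite !raddf_sum /=; apply: eq_bigr => j _.
  rewrite linearZ_LR !ubt_FZ linearZ_LR ha (aFV j).1 (bFV j).1.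
  by case: letter_at; rewrite /= ?ha ?raddf0.
- have [f ->] := expand x; rewrite !raddf_sum /=; apply: eq_bigr => j _.
  (* Semilinearity of V applies to p-th powers, and its values are given at successors. Hence the
     coefficient is written as a p-th power and the index is raised by the period. *)
  rewrite linearZ_LR -(prootK p_char (f j)) !ubt_VZ linearZ_LR ha.
  rewrite -a_per -b_per; have -> : (j + m.*2 = (j + m.*2.-1).+1)%N by lia.
  rewrite (aFV _).2 (bFV _).2.
  by case: letter_at; rewrite /= ?ha ?raddf0.
- have [f ->] := expand x; have [g ->] := expand y.
  have h_sum f' : h (\sum_(j < m.*2) f' j *: a j) = \sum_(j < m.*2) f' j *: b j.
    by rewrite raddf_sum; apply: eq_bigr => j _; rewrite /= linearZ_LR ha.
  rewrite !h_sum !form_expand; apply: eq_bigr => i _; apply: eq_bigr => j _.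
  by rewrite a_lam b_lam.
- rewrite a_part b_part => /(memv_img (linfun h)); rewrite limg_span lfunE.
  have -> : [seq linfun h v | v <- [seq a j | j <- iota 0 m.*2 & odd j == i]] =
            [seq b j | j <- iota 0 m.*2 & odd j == i].
    by rewrite -map_comp; apply: eq_map => j; rewrite [LHS]lfunE [LHS]ha.
  by [].
Qed.

(** The homomorphisms obtained in both directions are inverse to each other on the bases. *)
Lemma unicycle_iso m w c M N : (0 < m)%N ->
  is_unicycle_of m w c M -> is_unicycle_of m w c N -> isomorphic M N.
Proof.
move=> m_gt0 [a a_cycle] [b b_cycle].
have [h [ha hF hV hlam hpart]] := unicycle_hom m_gt0 a_cycle b_cycle.
have [g [gb _ _ _ gpart]] := unicycle_hom m_gt0 b_cycle a_cycle.
have hK : cancel h g.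
  move=> x; have [_ /basis_expansion/(_ x)[f ->] _ _ _] := a_cycle.
  by rewrite !raddf_sum; apply: eq_bigr => j _; rewrite /= !linearZ_LR ha gb.
have gK : cancel g h.
  move=> x; have [_ /basis_expansion/(_ x)[f ->] _ _ _] := b_cycle.
  by rewrite !raddf_sum; apply: eq_bigr => j _; rewrite /= !linearZ_LR gb ha.
exists h; split=> //; first by exists g.
by move=> i x; apply/idP/idP => [/gpart|/hpart //]; rewrite hK.
Qed.
End Isomorphisms.

(** * Even rotations of the basis of a unicycle *)

Section Rotation.
Variables (k : closedFieldType) (p : nat).
Hypothesis p_odd : odd p.

Lemma span_periodic (U : vectType k) (a : nat -> U) (P : pred nat) n j :
  (0 < n)%N -> (forall i, a (i + n)%N = a i) -> (forall i, P (i + n)%N = P i) ->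
  P j -> a j \in <<[seq a i | i <- iota 0 n & P i]>>%VS.
Proof.
move=> n_gt0 a_per P_per Pj; rewrite -(modn_periodic j a_per).
apply/memv_span/map_f; rewrite mem_filter mem_iota /= ltn_mod n_gt0 andbT.
by rewrite (modn_periodic _ P_per).
Qed.

Lemma span_rotation (U : vectType k) (a : nat -> U) (t : nat -> k)
    (P : pred nat) n s :
  (0 < n)%N -> (forall i, a (i + n)%N = a i) -> (forall i, P (i + n)%N = P i) ->
  (forall i, P (i + s)%N = P i) -> (forall i, t (i + n)%N = t i) ->
  (forall i, t i != 0) ->
  <<[seq t i *: a (i + s)%N | i <- iota 0 n & P i]>>%VS =
  <<[seq a i | i <- iota 0 n & P i]>>%VS.
Proof.
move=> n_gt0 a_per P_per P_s t_per t_neq0; apply/eqP; rewrite eqEsubv.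
apply/andP; split; apply/span_subvP=> v /mapP[j];
  rewrite mem_filter => /andP[Pj _] ->.
  by apply: memvZ; apply: span_periodic; rewrite ?P_s.
(* This i solves i + s = j modulo n; adding the multiple s n keeps the subtraction exact in nat. *)
pose b i := t i *: a (i + s)%N; pose i := (j + s * n - s)%N.
have is_j : (i + s = j + s * n)%N by rewrite /i subnK //; nia.
have mul_per (T : Type) (f : nat -> T) : (forall i, f (i + n)%N = f i) ->
    f (j + s * n)%N = f j.
  move=> f_per.
  by rewrite addnC -(modn_periodic _ f_per) modnMDl (modn_periodic _ f_per).
have -> : a j = (t i)^-1 *: b i.
  by rewrite /b scalerA mulVf // scale1r is_j mul_per.
apply: memvZ; apply: (span_periodic (a := b)) => // [i'|].
  by rewrite /b t_per addnAC a_per.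
by rewrite -P_s is_j mul_per.
Qed.

(* Rescaling the rotated basis by the powers [x ^+ p ^ j] turns the values
   [c ^+ p ^ (j + s)] of the form into [c ^+ p ^ j] exactly when
   [x ^+ (1 + p ^ m) = c / c ^+ p ^ s]. *)
Lemma unicycle_rotate m w w' (c : k) s (M : unitaryBT1 k p) :
  odd m -> c != 0 -> c ^+ (p ^ m) = - c -> ~~ odd s ->
  (forall j, letter_at w' j = letter_at w (j + s)) ->
  is_unicycle_of m w c M -> is_unicycle_of m w' c M.
Proof.
move=> m_odd c_neq0 c_conj s_even w'_w [a [a_per a_basis aFV a_lam a_part]].
have m_gt0 : (0 < m)%N by case: (m) m_odd.
have n_gt0 : (0 < m.*2)%N by rewrite double_gt0.
pose d := c / c ^+ (p ^ s).
have cs_neq0 : c ^+ (p ^ s) != 0 by rewrite expf_neq0.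
have [x /eqP x_def] := exists_root d (ltn0Sn (p ^ m)).
have x_neq0 : x != 0.
  apply: contra_eq_neq x_def => ->.
  by rewrite exprS mul0r eq_sym mulf_neq0 ?invr_neq0.
(* Numerator and denominator both change sign, since p^s is odd. *)
have d_fix : d ^+ (p ^ m) = d.
  rewrite /d exprMn exprVn -exprM mulnC exprM c_conj exprNn -signr_odd oddX p_odd.
  by rewrite orbT expr1 mulN1r invrN mulrNN.
(* The p^m-th power fixes x^(1 + p^m) = d; cancelling x^(p^m) gives the claim, which makes the
   scalars [t] periodic modulo 2m. *)
have x_fix : x ^+ (p ^ m.*2) = x.
  apply: (mulIf (expf_neq0 (p ^ m) x_neq0)).
  by rewrite -addnn expnD exprM -exprMn -exprSr -exprS x_def d_fix.
pose t j := x ^+ (p ^ j).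
have t_per j : t (j + m.*2)%N = t j by rewrite /t addnC expnD exprM x_fix.
have t_neq0 j : t j != 0 by rewrite expf_neq0.
have tS j : t j.+1 = t j ^+ p by rewrite /t expnSr exprM.
have odd_per j : odd (j + m.*2) = odd j by rewrite oddD odd_double addbF.
have odd_s j : odd (j + s) = odd j by rewrite oddD (negPf s_even) addbF.
exists (fun j => t j *: a (j + s)%N); split=> [j||j|i j|i].
- by rewrite t_per addnAC a_per.
- have size_a := size_basis (X := in_tuple _) a_basis.
  rewrite basisEdim size_a !size_map leqnn andbT.
  rewrite -[iota 0 m.*2]filter_predT (span_rotation (P := predT)) //.
  by rewrite filter_predT (span_basis a_basis).
- rewrite w'_w; split; first rewrite ubt_FZ (aFV _).1 tS.
    by case: letter_at; rewrite ?scaler0.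
  by rewrite tS addSn ubt_VZ (aFV _).2; case: letter_at; rewrite ?scaler0.
- rewrite linearZl_LR linearZr_LR /= a_lam addnAC eqn_modDr.
  case: eqP => [ji|_]; last by rewrite !mulr0.
  have -> : t j = t (i + m)%N.
    by rewrite -(modn_periodic j t_per) ji (modn_periodic _ t_per).
  rewrite /t !expnD mulnC ![(p ^ i * _)%N]mulnC.
  rewrite !exprM mulrA -!exprMn -exprS x_def /d divfK //.
- by rewrite a_part (span_rotation (P := fun j => odd j == i)) // => j;
    rewrite ?odd_per ?odd_s.
Qed.

End Rotation.

(* A map [M(u) -> M(u')] commuting with [F] and [V] can have a nonzero
   coefficient on [a'_i] in the image of [a_j] only if the letters of [u] read
   from [j] precede those of [u'] read from [i] lexicographically, with
   [f < v]; [code u n j] is the first [n] of those letters read as a binary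
   numeral, so that this order becomes that of nat. *)
Section Code.
Variable u : nat -> bool.

Fixpoint code n j :=
  if n is n'.+1 then (u j * 2 ^ n' + code n' j.+1)%N else 0%N.

Lemma code_lt n j : (code n j < 2 ^ n)%N.
Proof.
elim: n j => //= n IH j; rewrite expnS; have := IH j.+1.
by case: (u j) => /=; lia.
Qed.
End Code.

(** The remaining digits are too small to compensate for different leading ones, by [code_lt]. *)
Lemma code_inj u u' n i j :
  code u n i = code u' n j -> forall t, (t < n)%N -> u (i + t)%N = u' (j + t)%N.
Proof.
elim: n i j => //= n IH i j eq_code.
have := code_lt u n i.+1; have := code_lt u' n j.+1 => lt' lt.
have eq_u : u i = u' j by move: eq_code; case: (u i); case: (u' j) => //=; lia.
case=> [|t] t_lt; first by rewrite !addn0.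
rewrite -!addSnnS; apply: IH => //.
by move: eq_code; rewrite eq_u => /addnI.
Qed.

(** Applying the hypotheses alternately yields weakly decreasing codes at even positions. By
    induction on a bound v, the descent must stop, and there the codes of the two words coincide. *)
Lemma code_common (u u' : nat -> bool) n :
  (forall i, ~~ odd i -> exists2 j, ~~ odd j & (code u n j <= code u' n i)%N) ->
  (forall i, ~~ odd i -> exists2 j, ~~ odd j & (code u' n j <= code u n i)%N) ->
  exists i j, [/\ ~~ odd i, ~~ odd j & code u n i = code u' n j].
Proof.
move=> below below'.
suff descend v i : (code u n i <= v)%N -> ~~ odd i ->
    exists i j, [/\ ~~ odd i, ~~ odd j & code u n i = code u' n j].
  exact: (descend _ 0%N (leqnn _)).
elim: v i => [|v IH] i i_le i_even.
  have [j j_even ji] := below' i i_even; exists i, j; split=> //; lia.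
have [j j_even ji] := below' i i_even; have [l l_even lj] := below j j_even.
have [l_le|l_gt] := leqP (code u n l) v; first exact: IH l_le l_even.
by exists i, j; split=> //; lia.
Qed.

(** * Homomorphisms of standard modules and the order of their letters *)

Section StandardModules.
Variables (k : closedFieldType) (p : nat).
Hypothesis p_char : p \in [pchar k].
Hypothesis p_odd : odd p.
Variable m' : nat.
Notation m := m'.+1.
Notation n := m'.*2.+1.
Hypothesis m_odd : odd m.
Variable c : k.
Hypothesis c_neq0 : c != 0.
Hypothesis c_conj : c ^+ (p ^ m) = - c.
Variables u u' : nat -> bool.
Hypothesis u_flip : forall j, u (j + m) = ~~ u j.
Hypothesis u'_flip : forall j, u' (j + m) = ~~ u' j.

Notation M := (std_module p_char p_odd m_odd c_neq0 c_conj u_flip).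
Notation M' := (std_module p_char p_odd m_odd c_neq0 c_conj u'_flip).
Notation e := (cyc_row n k).

(** If the first letters agree, F or V relates this coefficient to the one at the next indices by a
    p-th power or root, so that one is nonzero too. The pair f, v settles the inequality; the pair
    v, f would make the coefficient zero. *)
Lemma hom_code (h : {linear M -> M'}) r i j :
  (forall x, h (ubt_F M x) = ubt_F M' (h x)) ->
  (forall x, h (ubt_V M x) = ubt_V M' (h x)) ->
  (h (e j) : 'rV[k]_n.+1) 0 (inZp i) != 0 -> (code u r j <= code u' r i)%N.
Proof.
move=> hF hV; elim: r i j => //= r IH i j hji.
have u'_ord : u' (inZp i : 'I_n.+1) = u' i by exact: (u_ord u'_flip).
case uj: (u j) => /=; last first.
  case u'i: (u' i) => /=.
    by have := code_lt u r j.+1; lia.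
  rewrite !mul0n !add0n; apply: IH.
  have := hF (e j); rewrite [ubt_F M _]std_F_cyc_row // uj => ->.
  by rewrite (inZpS _ i) [X in X != 0]std_FE u'_ord u'i expf_neq0.
have hjE : h (e j) = std_V p_char u' (h (e j.+1)).
  by rewrite -[RHS]hV [ubt_V M _]std_V_cyc_row // uj.
move: hji; rewrite {}hjE mxE u'_ord; case u'i: (u' i); rewrite ?eqxx //.
rewrite -inZpS => hji; rewrite !mul1n leq_add2l; apply: IH.
by apply: contraNneq hji => ->; rewrite proot0.
Qed.

(** By surjectivity some basis vector has an image with nonzero coefficient at i; since [h] respects
    the parts, its index is even like i. *)
Lemma iso_code r i : isomorphic M M' -> ~~ odd i ->
  exists2 j, ~~ odd j & (code u r j <= code u' r i)%N.
Proof.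
case=> h [[g hK gK] hF hV _ hpart] i_even.
have [j hji|h0] :=
  pickP (fun j : 'I_n.+1 => (h (e j) : 'rV[k]_n.+1) 0 (inZp i) != 0).
  exists (val j); last exact: (@hom_code h r i j hF hV hji).
  have : h (e j) \in std_part k m' (odd j).
    rewrite [_ \in _](hpart (odd j) (e j)); apply/std_partP=> l.
    by rewrite mxE valZpK /=; case: (l =P j) => //= ->; rewrite eqxx.
  move/std_partP/(_ (inZp i)) => hji0; apply: contraNN hji => j_odd.
  rewrite hji0 // j_odd /= (modn_periodic _ (odd_per m')) //.
  by rewrite (negPf i_even).
have : (h (g (e i)) : 'rV[k]_n.+1) 0 (inZp i) = 0.
  have -> : g (e i) = \sum_(j < n.+1) (g (e i) : 'rV[k]_n.+1) 0 j *: e j.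
    rewrite [LHS]row_sum_delta; apply: eq_bigr => j _.
    by rewrite /cyc_row valZpK.
  rewrite raddf_sum summxE big1 // => j _; rewrite /= linearZ_LR mxE.
  by have /negbFE/eqP -> := h0 j; rewrite mulr0.
by rewrite gK mxE !eqxx => /eqP; rewrite oner_eq0.
Qed.
End StandardModules.

(** * Words and subsets of Z/m *)

Section Words.
Implicit Types (w y z : seq letter).

Definition letter_of (b : bool) := if b then lv else lf.
Definition is_lv x := if x is lv then true else false.

Lemma is_lvK : cancel is_lv letter_of. Proof. by case. Qed.
Lemma star_letterK : involutive star_letter. Proof. by case. Qed.
Lemma star_letter_of b : star_letter (letter_of b) = letter_of (~~ b).
Proof. by case: b. Qed.

Lemma letter_at_mod w j : letter_at w (j %% size w) = letter_at w j.
Proof. by rewrite /letter_at modn_mod. Qed.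

Lemma size_yystar y : size (y ++ star y) = (size y).*2.
Proof. by rewrite size_cat size_map addnn. Qed.

(** Positions are counted from the right end, so the lower half of the indices lies in [star y]. *)
Lemma letter_at_yystar_lt y j : (j < size y)%N ->
  letter_at (y ++ star y) j = star_letter (nth lf (rev y) j).
Proof.
move=> j_lt; rewrite /letter_at size_yystar modn_small; last by lia.
rewrite rev_cat nth_cat size_rev size_map j_lt -map_rev (nth_map lf) //.
by rewrite size_rev.
Qed.

Lemma letter_at_yystarD y j : (0 < size y)%N ->
  letter_at (y ++ star y) (j + size y) = star_letter (letter_at (y ++ star y) j).
Proof.
move=> y_gt0; set m := size y in y_gt0 *; set w := y ++ star y.
have w_size : size w = m.*2 by exact: size_yystar.
have w_lt i : (i < m)%N -> letter_at w (i + m) = star_letter (letter_at w i).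
  move=> i_lt; rewrite [in RHS]letter_at_yystar_lt // star_letterK.
  rewrite /letter_at w_size modn_small; last by lia.
  rewrite rev_cat nth_cat size_rev size_map -/m ifF ?addnK //.
  by apply/negbTE; lia.
rewrite -(letter_at_mod w (j + m)) -(letter_at_mod w j) -modnDml letter_at_mod.
have : (j %% size w < m.*2)%N by rewrite w_size ltn_pmod ?double_gt0.
move: (j %% size w)%N => i i_lt.
have [/w_lt //|m_le] := ltnP i m.
rewrite -[in RHS](subnK m_le) [in RHS]w_lt ?star_letterK; last by lia.
rewrite -letter_at_mod w_size.
have -> : (i + m = i - m + m.*2)%N by lia.
by rewrite modnDr -w_size letter_at_mod.
Qed.

Lemma nth_flatten_nseq n z j : (j < n * size z)%N ->
  nth lf (flatten (nseq n z)) j = nth lf z (j %% size z).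
Proof.
elim: n j => //= n IH j; rewrite mulSn nth_cat => j_lt.
case: ltnP => [/modn_small -> //|z_le].
rewrite IH; last by lia.
by rewrite -[in RHS](subnK z_le) modnDr.
Qed.

Lemma size_flatten_nseq n z : size (flatten (nseq n z)) = (n * size z)%N.
Proof. by elim: n => //= n IH; rewrite size_cat IH mulSn. Qed.

Lemma rev_flatten_nseq n z : rev (flatten (nseq n z)) = flatten (nseq n (rev z)).
Proof. by rewrite rev_flatten map_nseq rev_nseq. Qed.

Lemma letter_at_flatten n z j :
  letter_at (flatten (nseq n z)) (j + size z) = letter_at (flatten (nseq n z)) j.
Proof.
have [nz0|nz_gt0] := posnP (n * size z).
  have /size0nil -> : size (flatten (nseq n z)) = 0%N by rewrite size_flatten_nseq.
  by rewrite /letter_at !nth_nil.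
rewrite /letter_at size_flatten_nseq rev_flatten_nseq.
rewrite !nth_flatten_nseq size_rev ?ltn_pmod //.
by rewrite !modn_dvdm ?dvdn_mull // modnDr.
Qed.

Lemma periodic_flatten w r : (r %| size w)%N ->
  (forall j, letter_at w (j + r) = letter_at w j) ->
  exists z, w = flatten (nseq (size w %/ r) z).
Proof.
move=> /dvdnP[n w_size] w_per.
have [r0|r_gt0] := posnP r.
  by exists [::]; rewrite (size0nil (_ : size w = 0%N)) ?w_size ?r0 ?muln0 // div0n.
(* The repeated block consists of the last r letters, those at positions 0 to r - 1. *)
exists (rev (take r (rev w))).
rewrite w_size mulnK // -rev_flatten_nseq -[LHS]revK; congr rev.
have [n0|n_gt0] := posnP n.
  by rewrite (size0nil (_ : size (rev w) = 0%N)) ?size_rev ?w_size ?n0.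
have r_size : size (take r (rev w)) = r.
  by rewrite size_takel // size_rev w_size leq_pmull.
apply: (eq_from_nth (x0 := lf)).
  by rewrite size_flatten_nseq r_size size_rev w_size.
move=> j; rewrite size_rev => j_lt.
rewrite nth_flatten_nseq r_size -?w_size // nth_take ?ltn_pmod //.
have := modn_periodic j w_per; rewrite /letter_at.
rewrite [((j %% r) %% size w)%N]modn_small; last first.
  by apply: leq_ltn_trans j_lt; apply: leq_mod.
by rewrite [(j %% size w)%N]modn_small.
Qed.
End Words.

(** * Dictionary between words and subsets of Z/m *)

Section NecklaceWords.
Variable m' : nat.
Notation m := m'.+1.
Hypothesis m_odd : odd m.
Implicit Types A B : {set 'I_m}.

(* A word [u] with [u (j + m) = star (u j)] is encoded by a subset of Z/m:
   since [m] is odd, Z/2m = Z/2 x Z/m, and exchanging the letters at odd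
   positions makes [u] invariant under translation by [m]. *)
Definition letters A j : bool := (inZp j \in A) (+) odd j.

Lemma letters_flip A j : letters A (j + m) = ~~ letters A j.
Proof. by rewrite /letters -inZp_mod modnDr inZp_mod oddD m_odd addbT addbN. Qed.

Lemma letters_per A j : letters A (j + m.*2) = letters A j.
Proof. exact: (double_period negbK (letters_flip A)). Qed.

(** The negation appears because [word_of A] occupies the positions m to 2m - 1, where the letters
    are flipped. *)
Definition word_of A := rev (mkseq (fun j => letter_of (~~ letters A j)) m).

Lemma size_word_of A : size (word_of A) = m.
Proof. by rewrite size_rev size_mkseq. Qed.

Lemma letter_at_word_of A j :
  letter_at (word_of A ++ star (word_of A)) j = letter_of (letters A j).
Proof.
set w := _ ++ _.
have w_flip i : letter_at w (i + m) = star_letter (letter_at w i).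
  by rewrite -[in LHS](size_word_of A) letter_at_yystarD ?size_word_of.
have w_lt i : (i < m)%N -> letter_at w i = letter_of (letters A i).
  move=> i_lt; rewrite letter_at_yystar_lt ?size_word_of // revK nth_mkseq //.
  by rewrite star_letter_of negbK.
rewrite -(modn_periodic j (double_period star_letterK w_flip)).
rewrite -(modn_periodic j (letters_per A)).
have : (j %% m.*2 < m.*2)%N by rewrite ltn_pmod.
move: (j %% _)%N => i i_lt; have [/w_lt //|m_le] := ltnP i m.
rewrite -(subnK m_le) w_flip letters_flip w_lt ?star_letter_of //; lia.
Qed.

Lemma letter_at_letters y : size y = m ->
  exists A, forall j, letter_at (y ++ star y) j = letter_of (letters A j).
Proof.
move=> y_size; pose g j := is_lv (letter_at (y ++ star y) j) (+) odd j.
have g_per j : g (j + m)%N = g j.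
  rewrite /g -[in letter_at _ _]y_size letter_at_yystarD ?y_size //.
  by rewrite oddD m_odd; case: letter_at; case: odd.
exists [set i : 'I_m | g i] => j.
by rewrite /letters inE /= (modn_periodic _ g_per) /g addbK is_lvK.
Qed.

Lemma stab_RsP A (t : 'I_m) :
  reflect (forall x, (x + t \in A) = (x \in A)) (t \in 'C[A | 'Rs])%g.
Proof.
apply: (iffP astab1P) => [/= At x | At] /=.
  by rewrite -[in LHS]At rcosetE mem_rcoset mulgK.
by apply/setP=> x; rewrite rcosetE mem_rcoset -At [(_ + _)%R]mulgKV.
Qed.

(** The even representative modulo 2m of a residue modulo m; it exists because m is odd. *)
Definition even_lift (i : 'I_m) : nat := (if odd i then i + m else i)%N.

Lemma odd_even_lift i : ~~ odd (even_lift i).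
Proof. by rewrite /even_lift; case: ifPn => //; rewrite oddD m_odd => ->. Qed.

Lemma inZp_even_lift i : inZp (even_lift i) = i.
Proof.
rewrite /even_lift; case: ifP => _; last exact: valZpK.
by rewrite -inZp_mod modnDr inZp_mod valZpK.
Qed.

(** Even shifts preserve parity, so the parity terms cancel and rotations of words become
    translations of subsets. *)
Lemma letters_even_shift A B s t : ~~ odd s -> ~~ odd t ->
  (forall j, letters A (s + j) = letters B (t + j)) <->
  (forall x, (inZp s + x \in A) = (inZp t + x \in B)).
Proof.
move=> /negPf s_even /negPf t_even; split=> [AB x | AB j].
  have := AB x; rewrite /letters !inZpD valZpK !oddD s_even t_even.
  by move/addIb.
by rewrite /letters !inZpD AB !oddD s_even t_even.
Qed.

(** A nonzero stabilising t lifts to an even period s < 2m, and gcd(2m, s) exhibits the word as a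
    proper power. Conversely, the length of a repeated block is a period of the letters. *)
Lemma primitiveP y A : size y = m ->
  (forall j, letter_at (y ++ star y) j = letter_of (letters A j)) ->
  primitive (y ++ star y) <-> ('C[A | 'Rs] = 1)%g.
Proof.
move=> y_size yA; set w := y ++ star y.
have w_size : size w = m.*2 by rewrite size_yystar y_size.
split=> [w_prim | A_aper n z n_gt1 w_z].
  apply/trivgP/subsetP=> t /stab_RsP At; rewrite inE; apply/eqP.
  apply: contraTeq isT => t_neq0; set s := even_lift t.
  have s_lt : (s < m.*2)%N.
    by rewrite /s /even_lift; have := ltn_ord t; case: ifP => _; lia.
  have s_gt0 : (0 < s)%N.
    rewrite lt0n; apply: contra_neq t_neq0 => s0.
    by rewrite -(inZp_even_lift t) -/s s0; apply: val_inj.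
  have As j : letters A (j + s) = letters A j.
    rewrite addnC -[j in RHS]add0n; move: j.
    apply/letters_even_shift => [||x] //; first exact: odd_even_lift.
    rewrite inZp_even_lift addrC At; congr (_ \in A).
    by rewrite -[LHS]add0r; congr (_ + _); apply: val_inj.
  pose g := gcdn m.*2 s.
  have Ag j : letters A (j + g) = letters A j.
    have As_mul i a : letters A (i + a * s) = letters A i.
      elim: a i => [|a IH] i; first by rewrite addn0.
      by rewrite mulSn addnA IH As.
    (* Bezout without subtraction: g + a s is a multiple of 2m. *)
    have [a _ /dvdnP[b gab]] := Bezoutl s (ltn0Sn m'.*2.+1).
    rewrite -(As_mul _ a) -addnA gab.
    by elim: b {gab} => [|b IH]; rewrite ?addn0 // mulSn addnCA addnC letters_per.
  have g_dvd : (g %| size w)%N by rewrite w_size dvdn_gcdl.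
  have w_per j : letter_at w (j + g) = letter_at w j by rewrite !yA Ag.
  have [z w_z] := periodic_flatten g_dvd w_per.
  have g_gt0 : (0 < g)%N by rewrite gcdn_gt0 double_gt0.
  case: (w_prim _ z _ w_z); rewrite ltn_divRL // mul1n w_size.
  by apply: leq_ltn_trans s_lt; rewrite dvdn_leq ?dvdn_gcdr.
set r := size z.
have nr : (n * r = m.*2)%N by rewrite -w_size w_z size_flatten_nseq.
have Ar j : letters A (j + r) = letters A j.
  have := letter_at_flatten n z j; rewrite -w_z !yA.
  by case: (letters A _); case: (letters A _).
(* An odd period r would divide m, contradicting [letters_flip]. An even one stabilises [A], so m
   and then 2m divides r, which excludes n > 1. *)
have [r_odd | r_even] := boolP (odd r).
  have n_even : ~~ odd n.
    by have := congr1 odd nr; rewrite oddM r_odd andbT odd_double => ->.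
  have m_r : (m = n./2 * r)%N.
    by apply: double_inj; rewrite -nr doubleMl even_halfK.
  have Ar_mul a : letters A (a * r) = letters A 0.
    by elim: a => // a IH; rewrite mulSn addnC Ar.
  have := letters_flip A 0; rewrite add0n [in LHS]m_r Ar_mul.
  by case: (letters A 0).
have : inZp r \in ('C[A | 'Rs])%g.
  apply/stab_RsP=> x; rewrite addrC.
  have /letters_even_shift -> // : forall j, letters A (r + j) = letters A (0 + j).
    by move=> j; rewrite addnC Ar.
  congr (_ \in A); rewrite -[RHS]add0r; congr (_ + _); exact: val_inj.
rewrite A_aper inE => /eqP/(congr1 val)/=/eqP; rewrite -/(dvdn m r) => m_dvd.
have two_m_dvd : (m.*2 %| r)%N.
  by rewrite -muln2 Gauss_dvd ?coprimen2 // m_dvd dvdn2.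
have r_gt0 : (0 < r)%N by case: posnP nr => // ->; rewrite muln0.
have := dvdn_leq r_gt0 two_m_dvd; rewrite -nr.
by rewrite -[X in (_ <= X)%N]mul1n leq_pmul2r // leqNgt n_gt1.
Qed.

(** Of the positions i and i + m exactly one has parity b, and its letter is v exactly when i is
    counted on the right. *)
Lemma count_letters A b :
  count (fun j => (odd j == b) && letters A j) (iota 0 m.*2) =
  #|[set i : 'I_m | (i \in A) (+) b]|.
Proof.
rewrite -addnn iotaD count_cat add0n -{2}[m]addn0 iotaDl count_map.
rewrite -!sumn_count !sumnE !big_map -[iota 0 m]/(index_iota 0 m) -big_split /=.
rewrite big_mkord -sum1_card [RHS]big_mkcond; apply: eq_bigr => i _.
have m'_even : odd m' = false by apply/negbTE.
rewrite inE (addnC m) letters_flip /letters valZpK oddD m'_even /=.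
by case: (_ \in _); case: (odd i); case: b.
Qed.

Lemma letters_of_orbit A B : B \in orbit 'Rs%act [set: 'I_m]%g A ->
  exists2 t, ~~ odd t & forall j, letters A j = letters B (j + t).
Proof.
case/orbitP=> t _ <-; exists (even_lift t) => [|j]; first exact: odd_even_lift.
rewrite addnC -[j in LHS]add0n; move: j.
apply/letters_even_shift => // [|x]; first exact: odd_even_lift.
rewrite inZp_even_lift /= rcosetE mem_rcoset addrC [in RHS]addrC.
rewrite [X in _ = (X \in A)]mulgK; congr (_ \in A).
by rewrite -[RHS]addr0; congr (_ + _); apply: val_inj.
Qed.

Lemma orbit_of_letters A B s t : ~~ odd s -> ~~ odd t ->
  (forall j, letters A (s + j) = letters B (t + j)) ->
  B \in orbit 'Rs%act [set: 'I_m]%g A.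
Proof.
move=> s_even t_even /letters_even_shift => /(_ s_even t_even) AB.
apply/orbitP.
exists (inZp t - inZp s); first by rewrite inE.
apply/setP=> x; rewrite /= rcosetE mem_rcoset.
have -> : (x * (inZp t - inZp s)^-1)%g = inZp s + (x - inZp t).
  by rewrite -[LHS]/(x - (inZp t - inZp s)) opprB addrCA.
by rewrite AB addrC subrK.
Qed.

End NecklaceWords.

(** * Isomorphism classes of unicycles as translation orbits *)

Section Classification.
Variables (k : closedFieldType) (p : nat).
Hypothesis p_char : p \in [pchar k].
Hypothesis p_odd : odd p.
Variable m' : nat.
Notation m := m'.+1.
Hypothesis m_odd : odd m.
Variable c : k.
Hypothesis c_neq0 : c != 0.
Hypothesis c_conj : c ^+ (p ^ m) = - c.
Implicit Types A B : {set 'I_m}.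

Definition necklace_module A : unitaryBT1 k p :=
  std_module p_char p_odd m_odd c_neq0 c_conj (letters_flip m_odd A).

Lemma necklace_unicycle A w :
  (forall j, letter_at w j = letter_of (letters A j)) ->
  is_unicycle_of m w c (necklace_module A).
Proof. exact: std_unicycle. Qed.

Lemma necklace_dim_kerF A b r :
  dim_kerF (necklace_module A) b r <-> r = #|[set i : 'I_m | (i \in A) (+) b]|.
Proof.
rewrite -(count_letters m_odd); have dim_r :=
  std_dim_kerF p_char p_odd m_odd c_neq0 c_conj (letters_flip m_odd A) b.
by split=> [/dim_kerF_inj/(_ dim_r)|->].
Qed.

Lemma necklace_signature A s :
  has_signature (necklace_module A) s <-> s = ((m - #|A|)%N, #|A|).
Proof.
rewrite /has_signature !necklace_dim_kerF.
have -> : [set i : 'I_m | (i \in A) (+) true] = ~: A.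
  by apply/setP=> i; rewrite !inE addbT.
have -> : [set i : 'I_m | (i \in A) (+) false] = A.
  by apply/setP=> i; rewrite inE addbF.
rewrite cardsCs setCK card_ord.
by case: s => s1 s2 /=; split=> [[-> ->]|[-> ->]].
Qed.

(** An isomorphism and its inverse give the two hypotheses of [code_common], hence equal readings
    from even positions. Conversely, a translation is an even rotation, handled by
    [unicycle_rotate]. *)
Lemma necklace_isoP A B :
  isomorphic (necklace_module A) (necklace_module B) <->
  B \in orbit 'Rs%act [set: 'I_m]%g A.
Proof.
split=> [AB | /(letters_of_orbit m_odd)[t t_even AB]].
  have [i i_even|i i_even|s [t [s_even t_even]]] :=
    code_common (u := letters A) (u' := letters B) (n := m.*2).
  - exact: iso_code AB i_even.
  - exact: iso_code (isomorphic_sym AB) i_even.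
  move/code_inj => eq_st; apply: (orbit_of_letters s_even t_even) => j.
  (* Equal codes compare one period of 2m letters; periodicity extends this to all j. *)
  have per (f : nat -> bool) r : (forall i, f (i + m.*2)%N = f i) ->
      f (r + j %% m.*2)%N = f (r + j)%N.
    move=> f_per.
    by rewrite -(modn_periodic _ f_per) modnDmr (modn_periodic _ f_per).
  rewrite -(per _ s (letters_per m_odd A)) -(per _ t (letters_per m_odd B)).
  by rewrite eq_st ?ltn_pmod.
have wA := letter_at_word_of m_odd A; have wB := letter_at_word_of m_odd B.
apply: (unicycle_iso p_char (ltn0Sn m') (necklace_unicycle wA)).
apply: (unicycle_rotate p_odd m_odd c_neq0 c_conj t_even) (necklace_unicycle wB).
by move=> j; rewrite wA wB AB.
Qed.

Lemma unicycle_necklace y (M : unitaryBT1 k p) : size y = m ->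
  primitive (y ++ star y) -> is_unicycle_of m (y ++ star y) c M ->
  exists2 A, ('C[A | 'Rs] = 1)%g & isomorphic M (necklace_module A).
Proof.
move=> y_size y_prim M_y; have [A yA] := letter_at_letters m_odd y_size.
exists A; first exact/(primitiveP m_odd y_size yA).
exact: (unicycle_iso p_char (ltn0Sn m') M_y (necklace_unicycle yA)).
Qed.
End Classification.

(** * The number of isomorphism classes of given signature *)

Theorem corollaryA18 (k : closedFieldType) (p : nat)
    (p_char : p \in [pchar k]) (p_gt2 : (2 < p)%N)
    (c : nat -> k)
    (c_spec : forall m : nat, odd m -> c m != 0 /\ c m ^+ (p ^ m) = - c m)
    (q b : nat) (q_odd : odd q) (b_le_q : (b <= q)%N) :
  exists n : nat,
    has_card (@Uni k p c ((q - b)%N, b)) n /\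
    n%:R = q%:R^-1 * \sum_(d <- divisors (gcdn q b))
                       (mobius d)%:~R * 'C(q %/ d, b %/ d)%:R :> rat.
Proof.
have p_odd : odd p.
  by case: (even_prime (pcharf_prime p_char)) p_gt2 => // ->.
case: q q_odd b_le_q => // q' q_odd b_le_q; set q := q'.+1.
have [c_neq0 c_conj] := c_spec q q_odd.
pose M := necklace_module p_char p_odd q_odd c_neq0 c_conj.
pose P := aperiodic_sets 'I_q b.
pose X := orbit_transversal 'Rs [set: 'I_q]%g P.
have [_ /subsetP sXP X_inj X_orbit] :=
  orbit_transversalP (acts_aperiodic_sets 'I_q b).
(* Each class has one representative in the transversal [X], and q times its cardinality is that of
   [P]. *)
exists #|X|; split; last first.
  have card_P := card_aperiodic_sets b (_ : cyclic [set: 'I_q])%g.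
  have q_neq0 : q%:R != 0 :> rat by rewrite pnatr_eq0.
  apply: (mulfI q_neq0); rewrite mulVKf // mulrC -natrM.
  rewrite -[q in LHS](card_ord q) card_orbit_transversal_aperiodic.
  rewrite -[LHS]/(#|P|%:Z%:~R) card_P; last first.
    by apply/cyclicP; exists Zp1; rewrite -Zp_cycle.
  rewrite card_ord rmorph_sum; apply: eq_bigr => d _.
  by rewrite rmorphM.
exists (fun i => iso_class (M (enum_val i))) => [i j | C].
  move/iso_class_eq/necklace_isoP; rewrite X_inj ?enum_valP // => /eqP.
  exact: enum_val_inj.
split=> [[N [[y [y_odd y_prim N_y]] N_sig ->]] | [i ->]].
  (* The two entries of the signature add up to the length of y, and q - b and b add up to q because
     b <= q. *)
  have y_size : size y = q.
    case y_sz : (size y) y_odd N_y => [//|m'] m_odd N_y.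
    have [cm_neq0 cm_conj] := c_spec m'.+1 m_odd.
    have [A _ /isomorphic_signature/(_ N_sig)/necklace_signature[]] :=
      unicycle_necklace p_char p_odd m_odd cm_neq0 cm_conj y_sz y_prim N_y.
    have := subset_leq_card (subsetT A); rewrite cardsT card_ord.
    by move: #|A| b_le_q => a; rewrite /q; lia.
  rewrite y_size in N_y.
  have [A A_aper N_A] :=
    unicycle_necklace p_char p_odd q_odd c_neq0 c_conj y_size y_prim N_y.
  have [_ A_b] :=
    (necklace_signature _ _ _ _ _ _ _).1 (isomorphic_signature N_A N_sig).
  have AP : A \in P by rewrite inE -A_b eqxx A_aper eqxx.
  (* [A] is replaced by the representative of its orbit in [X], which has an isomorphic module. *)
  have [t _ At] := X_orbit A AP.
  exists (enum_rank_in At ('Rs A t)%act); rewrite enum_rankK_in //.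
  apply/iso_class_eq/(isomorphic_trans N_A)/necklace_isoP.
  exact: mem_orbit (in_setT t).
set A := enum_val i; have AP : A \in P by apply/sXP/enum_valP.
move: AP; rewrite inE => /andP[/eqP A_b /eqP A_aper].
exists (M A); split=> //; last by apply/necklace_signature; rewrite A_b.
exists (word_of A); rewrite size_word_of; split=> //.
  exact/(primitiveP q_odd (size_word_of A) (letter_at_word_of q_odd A)).
exact/necklace_unicycle/letter_at_word_of.
Qed.
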